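(* The Lie algebra $\mathbf g=\mathfrak{sl}_3(\mathbb R)$ is reductive with respect to a $4$-dimensional subalgebra $\mathbf h$ of $\mathbf g$ and a complementary subspace $\mathbf m$ generating $\mathbf g$, up to conjugation, only in the case $\mathbf h=\langle e_5,e_6,e_7,e_8\rangle\cong\mathfrak{gl}_2(\mathbb R)$ and $\mathbf m=\langle e_1,e_2,e_3,e_4\rangle$.
   Context: $\mathbf g=\mathfrak{sl}_3(\mathbb R)$ has the basis $e_1,\dots,e_8$ determined by $$\sum_{i=1}^8\lambda_i e_i=\begin{pmatrix}-\lambda_5-\lambda_8&\lambda_1&\lambda_2\\ \lambda_3&\lambda_5&\lambda_6\\ \lambda_4&\lambda_7&\lambda_8\end{pmatrix},\qquad\lambda_i\in\mathbb R.$$ $\langle\cdots\rangle$ denotes the real linear span. $\mathbf g$ is reductive with respect to $\mathbf h$ and $\mathbf m$ if $\mathbf h$ is a subalgebra, $\mathbf m$ is a subspace, $\mathbf g=\mathbf m\oplus\mathbf h$ and $[\mathbf h,\mathbf m]\subseteq\mathbf m$. ''$\mathbf m$ generates $\mathbf g$'' means generation as a Lie algebra. ''Up to conjugation'' means that the pair $(\mathbf h,\mathbf m)$ may be replaced by its image under $Ad_g$, $g\in SL_3(\mathbb R)$. *)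

(* Defs.v *)
From mathcomp Require Import all_boot all_algebra reals.

Set Implicit Arguments.
Unset Strict Implicit.
Unset Printing Implicit Defensive.

Import GRing.Theory.
Local Open Scope ring_scope.

Section MatrixLieAlgebras.
Variables (K : fieldType) (n : nat).
Implicit Types (x y a : 'M[K]_n) (g h m : {vspace 'M[K]_n}).

Definition lie x y : 'M[K]_n := x *m y - y *m x.

Definition gl : {vspace 'M[K]_n} := fullv.

Definition sl : {vspace 'M[K]_n} := lker (linfun (@mxtrace K n : _ -> K^o)).

Lemma mem_sl x : (x \in sl) = (\tr x == 0).
Proof. by rewrite memv_ker lfunE. Qed.

Definition lie_subalgebra g h : Prop :=
  (h <= g)%VS /\ {in h &, forall x y, lie x y \in h}.

Lemma lie_subalgebra_sl : lie_subalgebra gl sl.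
Proof.
split=> [|x y _ _]; first exact: subvf.
by rewrite mem_sl /lie linearB /= mxtrace_mulC subrr.
Qed.

Definition reductive_pair g h m : Prop :=
  [/\ lie_subalgebra g h, directv (m + h)%VS, (m + h)%VS = g
    & {in h & m, forall x y, lie x y \in m}].

(* The smallest Lie subalgebra of g containing m is g. *)
Definition lie_generates g m : Prop :=
  forall k, lie_subalgebra g k -> (m <= k)%VS -> k = g.

Definition Ad a : 'End('M[K]_n) := linfun (mulmxr (invmx a) \o mulmx a).

Lemma AdE a x : Ad a x = a *m x *m invmx a.
Proof. by rewrite lfunE. Qed.

End MatrixLieAlgebras.

Arguments gl : clear implicits.
Arguments sl : clear implicits.

(* Only the restriction of f to h matters. *)
Definition lie_isomorphic (K : fieldType) (n p : nat)
    (h : {vspace 'M[K]_n}) (k : {vspace 'M[K]_p}) : Prop :=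
  exists f : 'Hom('M[K]_n, 'M[K]_p),
    [/\ (f @: h)%VS = k, {in h &, injective f}
      & {in h &, forall x y, f (lie x y) = lie (f x) (f y)}].

Section BasisOfSl3.
Variable K : fieldType.

(* Only the values l 1, ..., l 8 are used. *)
Definition sl3mx (l : nat -> K) : 'M[K]_3 :=
  \matrix_(i, j) nth 0 (nth [::]
    [:: [:: - l 5 - l 8; l 1; l 2];
        [:: l 3;         l 5; l 6];
        [:: l 4;         l 7; l 8]] i) j.

Definition e (i : nat) : 'M[K]_3 := sl3mx (fun j => (j == i)%:R).

Lemma sum_e (l : nat -> K) : \sum_(1 <= i < 9) l i *: e i = sl3mx l.
Proof.
rewrite unlock /=; apply/matrixP => -[[|[|[|//]]] ?] [[|[|[|//]]] ?];
  by rewrite !mxE /= ?(mulr0, mulr1, oppr0, subr0, sub0r, add0r, addr0, mulrN).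
Qed.

End BasisOfSl3.

Arguments e : clear implicits.

(* Main.v *)
Require Import Defs.
From HB Require Import structures.
From mathcomp Require Import all_boot all_algebra reals.
From mathcomp Require Import ring zify.
Set Implicit Arguments.
Unset Strict Implicit.
Unset Printing Implicit Defensive.

Import GRing.Theory Num.Theory.
Local Open Scope ring_scope.

(** That the standard pair qualifies is a direct computation; the brackets of
    [e_3] and [e_4] with [e_1] and [e_2] give [e_5, ..., e_8].

    In the converse direction everything reduces to one claim: some idempotent
    [c] of trace 1 commutes with all of [h].  Conjugating [c] to the matrix
    unit E11 puts [h] inside the centralizer of E11 in sl_3, which has
    dimension 4 like [h], so the two agree.  Then diag(-2, 1, 1) lies in the
    conjugate of [h]; its adjoint action has kernel the conjugate of [h] and
    eigenvalues 3 and -3 on [<e_1, ..., e_4>], so an invariant complement of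
    the kernel can only be [<e_1, ..., e_4>]
    ([reductive_pair_idempotent]).

    To find [c], start from a nonzero upper triangular [x] in [h], which exists
    because 4 + 5 > 8 ([exists_upper_trig]); all eigenvalues of [x], hence of
    [ad x], are in the base field.  There are three cases.
    - [ad x] is nilpotent on [h] and [x] is not nilpotent.  As [x] has trace 0,
      one of its eigenvalues is simple, and the elements of [h] preserve the
      generalized eigenspaces of [x], so the spectral projector of that
      eigenvalue commutes with [h] ([upper_trig_idempotent]).
    - [ad x] is not nilpotent on [h].  By Fitting's lemma and triangularity
      [h] contains an eigenvector of [ad x] for a nonzero eigenvalue, and such
      an eigenvector is a nilpotent matrix ([ad_trig_eigenvector],
      [lie_eigen_nilpotent]).
    - [x] is nilpotent.
    So in the last two cases [h] contains a nonzero nilpotent [y], and here the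
    invariant complement [m] enters, in two ways ([nilpotent_idempotent]).
    First, [ad y] is nilpotent on the 4-dimensional spaces [h] and [m], so
    [(ad y)^4 = 0] on sl_3; but [(ad y)^4 z = 6 y^2 z y^2], so [y^2 = 0], and
    [y] may be taken to be E13.  Second, the projection of sl_3 onto [h] along
    [m] commutes with [ad y], so it maps E31 to some [f] in [h] with
    [[y, [y, f]] = -2 y].  As in Morozov's lemma this yields a full
    sl_2-triple in [h], after a further conjugation the one spanned by E13,
    diag(1, 0, -1) and E31.  Only one dimension of [h] is left, while a nonzero
    element of weight 1 or -1 would give one of the opposite weight as well;
    hence [h] has only the weights 2, 0, -2 and commutes with E22. *)

(** * Nilpotent endomorphisms on invariant subspaces *)

Section Fitting.
Variables (K : fieldType) (vT : vectType K) (f : 'End(vT)) (U : {vspace vT}).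
Hypothesis fU : (f @: U <= U)%VS.

Let img n : {vspace vT} := iter n (fun W => f @: W)%VS U.

Let img_decr n : (img n.+1 <= img n)%VS.
Proof. by elim: n => [|n IHn]; [apply: fU | apply: limgS IHn]. Qed.

(** The dimensions of the iterated images of [U] decrease until two consecutive
    images agree, which happens after at most [\dim U] steps. *)
Lemma fitting_img_stable : (f @: img (\dim U) = img (\dim U))%VS.
Proof.
suff [k lek eqk] : exists2 k, (k <= \dim U)%N & img k.+1 = img k.
  rewrite -(subnK lek); elim: (\dim U - k)%N => [|n IHn]; first exact: eqk.
  exact: (congr1 (fun W => f @: W)%VS IHn).
have: forall n, (\dim (img n) + n <= \dim U)%N \/
    exists2 k, (k <= n)%N & img k.+1 = img k.
  elim=> [|n [IHn|[k lekn eqk]]]; first by left; rewrite addn0.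
    have [eqn | ltn] := eqVneq (\dim (img n.+1)) (\dim (img n)).
      right; exists n => //; apply/eqP.
      by rewrite eqEdim img_decr eqn leqnn.
    left; apply: leq_trans IHn; rewrite addnS ltn_add2r.
    by rewrite ltn_neqAle ltn dimvS // img_decr.
  by right; exists k => //; apply: leqW.
case/(_ (\dim U)) => [|//].
rewrite -[X in (_ <= X)%N]add0n leq_add2r leqn0 dimv_eq0.
by move=> /eqP img0; exists (\dim U) => //=; rewrite -/(img _) img0 limg0.
Qed.

Lemma memv_iter_img n v : v \in U -> iter n f v \in img n.
Proof. by move=> Uv; elim: n => //= n IHn; apply: memv_img. Qed.

Lemma nilpotent_iter_dim N v :
  {in U, forall w, iter N f w = 0} -> v \in U -> iter (\dim U) f v = 0.
Proof.
move=> fN0 Uv.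
have img_iter n w : w \in img n -> exists2 u, u \in U & w = iter n f u.
  elim: n w => [|n IHn] w /=; first by exists w.
  by case/memv_imgP=> w' /IHn[u Uu ->] ->; exists u.
have stab n : iter n (fun W => f @: W)%VS (img (\dim U)) = img (\dim U).
  by elim: n => //= n ->; apply: fitting_img_stable.
have := memv_iter_img (\dim U) Uv.
rewrite -(stab N) /img -iterD addnC iterD.
have -> : iter N (fun W => f @: W)%VS U = 0%VS.
  apply/eqP; rewrite -subv0; apply/subvP=> w /img_iter[u Uu ->].
  by rewrite fN0 // mem0v.
rewrite (_ : iter _ _ 0%VS = 0%VS) ?memv0 => [/eqP //|].
by elim: (\dim U) => //= n ->; rewrite limg0.
Qed.

End Fitting.

(** * Conjugation and the adjoint action *)

Section Lie.
Variables (K : fieldType) (n : nat).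
Implicit Types (x y z a : 'M[K]_n) (g h m : {vspace 'M[K]_n}).

Definition ad x : 'End('M[K]_n) := linfun (mulmx x \- mulmxr x).

Lemma adE x : ad x =1 lie x.
Proof. by move=> y; rewrite lfunE. Qed.

Lemma iter_adE x k z : iter k (ad x) z = iter k (lie x) z.
Proof. by elim: k => //= k ->; rewrite adE. Qed.

Lemma Ad_lie a x y : a \in unitmx -> Ad a (lie x y) = lie (Ad a x) (Ad a y).
Proof.
move=> ua; rewrite !AdE /lie mulmxBr mulmxBl !mulmxA.
by rewrite !(mulmxKV ua).
Qed.

Lemma invmxM a b : a \in unitmx -> b \in unitmx ->
  invmx (a *m b) = invmx b *m invmx a.
Proof.
move=> ua ub; have uab : a *m b \in unitmx by rewrite unitmx_mul ua.
by rewrite -[RHS](mulKmx uab) !mulmxA (mulmxK ub) (mulmxK ua).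
Qed.

Lemma Ad_mul a b h : a \in unitmx -> b \in unitmx ->
  (Ad (a *m b) @: h = Ad a @: (Ad b @: h))%VS.
Proof.
move=> ua ub; rewrite -limg_comp; apply: eq_in_limg => x _.
by rewrite comp_lfunE !AdE invmxM // !mulmxA.
Qed.

Lemma AdK a : a \in unitmx -> cancel (Ad a) (Ad (invmx a)).
Proof.
by move=> ua x; rewrite !AdE invmxK !mulmxA mulVmx // mul1mx mulmxKV.
Qed.

Lemma Ad_eq a x y : a \in unitmx -> a *m x = y *m a -> Ad a x = y.
Proof. by move=> ua ax; rewrite AdE ax mulmxK. Qed.

Lemma lker0_Ad a : a \in unitmx -> lker (Ad a) == 0%VS.
Proof. by move=> ua; apply/lker0P; apply: can_inj (AdK ua). Qed.

Lemma mxtrace_Ad a x : a \in unitmx -> \tr (Ad a x) = \tr x.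
Proof. by move=> ua; rewrite AdE mxtrace_mulC mulmxA mulVmx // mul1mx. Qed.

Lemma Ad_sl a : a \in unitmx -> (Ad a @: sl K n)%VS = sl K n.
Proof.
move=> ua; apply/eqP; rewrite eqEdim limg_dim_eq ?leqnn ?andbT.
  by apply/subvP=> _ /memv_imgP[x slx ->]; rewrite mem_sl mxtrace_Ad // -mem_sl.
by apply/eqP; rewrite (eqP (lker0_Ad ua)) capv0.
Qed.

Lemma dim_Ad a h : a \in unitmx -> \dim (Ad a @: h) = \dim h.
Proof. by move=> ua; rewrite limg_dim_eq // (eqP (lker0_Ad ua)) capv0. Qed.

Lemma lie_subalgebra_Ad a h : a \in unitmx ->
  lie_subalgebra (sl K n) h -> lie_subalgebra (sl K n) (Ad a @: h).
Proof.
move=> ua [hsl hlie]; split; first by rewrite -(Ad_sl ua) limgS.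
move=> _ _ /memv_imgP[x hx ->] /memv_imgP[y hy ->].
by rewrite -Ad_lie // memv_img // hlie.
Qed.

Lemma reductive_pair_Ad a h m : a \in unitmx ->
  reductive_pair (sl K n) h m ->
  reductive_pair (sl K n) (Ad a @: h) (Ad a @: m).
Proof.
move=> ua [hsub dir mh hm]; split.
- exact: lie_subalgebra_Ad.
- apply/directv_addP/eqP; rewrite -subv0; apply/subvP=> y.
  rewrite memv_cap => /andP[/memv_imgP[x mx ->] /memv_imgP[x' hx']].
  move=> /(can_inj (AdK ua)) eqx; rewrite memv0 {}eqx in mx *.
  have : x' \in (m :&: h)%VS by rewrite memv_cap mx.
  by rewrite (directv_addP dir) memv0 => /eqP->; rewrite linear0.
- by rewrite -limgD mh Ad_sl.
move=> _ _ /memv_imgP[x hx ->] /memv_imgP[y my ->].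
by rewrite -Ad_lie // memv_img // hm.
Qed.

Lemma lieM x y z : lie x (y *m z) = lie x y *m z + y *m lie x z.
Proof. by rewrite /lie mulmxBl mulmxBr !mulmxA addrA subrK. Qed.

Lemma lie_eigenM x y z (k l : K) : lie x y = k *: y -> lie x z = l *: z ->
  lie x (y *m z) = (k + l) *: (y *m z).
Proof. by move=> xy xz; rewrite lieM xy xz -scalemxAl -scalemxAr scalerDl. Qed.

Lemma mxtrace_lie x y : \tr (lie x y) = 0.
Proof. by rewrite /lie linearB /= mxtrace_mulC subrr. Qed.

Lemma mxtrace_lie_eigen x y (l : K) : l != 0 -> lie x y = l *: y -> \tr y = 0.
Proof.
move=> l0 xy; apply/eqP; have /eqP := mxtrace_lie x y.
by rewrite xy mxtraceZ mulf_eq0 (negPf l0).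
Qed.

Lemma lie_lie y z :
  lie y (lie y z) = y *m y *m z - (y *m z *m y) *+ 2 + z *m (y *m y).
Proof.
rewrite /lie mulmxBr mulmxBl !mulmxA mulr2n !opprD opprK.
by rewrite !addrA.
Qed.

(** In the binomial expansion of [(ad y)^4 z] only the term with two factors [y]
    on each side of [z] survives [y^3 = 0]. *)
Lemma lie4_sq y z : y *m y *m y = 0 ->
  iter 4 (lie y) z = 6 *: (y *m y *m z *m (y *m y)).
Proof.
have [q qE] : exists q, q = y *m y by eexists.
have [w w_def] : exists w, w = lie y (lie y z) by eexists.
rewrite /= -w_def lie_lie -qE => qy.
have yq : y *m q = 0 by rewrite qE mulmxA -qE.
have qq : q *m q = 0 by rewrite {2}qE mulmxA qy mul0mx.
rewrite lie_lie -qE in w_def.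
have qw : q *m w = q *m z *m q.
  rewrite w_def mulmxDr mulmxBr linearMn /= !mulmxA qq qy !mul0mx mul0rn.
  by rewrite subr0 add0r.
have wq : w *m q = q *m z *m q.
  rewrite w_def mulmxDl mulmxBl -!mulmxA qq !mulmx0 mulr2n mulmxDl -!mulmxA.
  by rewrite yq !(mulmx0, addr0, subr0).
have ywy : y *m w *m y = - (q *m z *m q) *+ 2.
  rewrite w_def mulmxDr mulmxDl mulmxBr mulmxBl !mulmxA yq !mul0mx sub0r.
  rewrite -!(mulmxA _ q) qy !mulmx0 addr0 mulr2n mulmxDr mulmxDl.
  by rewrite qE !mulmxA mulNrn mulr2n opprD.
rewrite qw wq ywy.
by rewrite !mulNrn opprK -mulrnA -mulrS -mulrSr scaler_nat.
Qed.

Lemma lie5_eq0 y z : y *m y *m y = 0 -> iter 5 (lie y) z = 0.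
Proof.
move=> y3; rewrite iterS lie4_sq // /lie -scalemxAr -scalemxAl.
have -> : y *m (y *m y *m z *m (y *m y)) = 0 by rewrite !mulmxA y3 !mul0mx.
have -> : y *m y *m z *m (y *m y) *m y = 0 by rewrite -mulmxA y3 mulmx0.
by rewrite subrr.
Qed.

End Lie.

(** * Consequences of nilpotency and triangularity of the adjoint action *)

Section AdNilpotent.
Variables (K : fieldType) (n : nat).
Implicit Types (x y z e c : 'M[K]_n) (W : {vspace 'M[K]_n}).

(** The hypotheses say that [e] is the spectral projector of a semisimple
    eigenvalue [l] of [x]: [x - l] vanishes on the image of [e] and has the
    inverse [c] on its kernel.  On [(1 - e) z e] the map [ad x] is left
    multiplication by [x - l], which is injective there, so nilpotency of
    [ad x] on [z] gives [(1 - e) z e = 0], and likewise [e z (1 - e) = 0]. *)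
Lemma idempotent_comm_of_ad_nilpotent x e c (l : K) k z :
    x *m e = l *: e -> e *m x = l *: e ->
    1%:M - e = c *m (x - l%:M) -> 1%:M - e = (x - l%:M) *m c ->
  iter k (lie x) z = 0 -> e *m z = z *m e.
Proof.
move=> xe ex cl cr nil_z.
set y : 'M[K]_n := x - l%:M in cl cr.
have ye : y *m e = 0 by rewrite mulmxBl xe mul_scalar_mx subrr.
have ey : e *m y = 0 by rewrite mulmxBr ex mul_mx_scalar subrr.
have lieB w : lie x w = y *m w - w *m y.
  rewrite /lie mulmxBl mulmxBr mul_scalar_mx mul_mx_scalar.
  by rewrite opprB addrA subrK.
have yC : (1%:M - e) *m y = y by rewrite mulmxBl mul1mx ey subr0.
have Cy : y *m (1%:M - e) = y by rewrite mulmxBr mulmx1 ye subr0.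
have [Ce eC] : (1%:M - e) *m (z *m e) = 0 /\ e *m z *m (1%:M - e) = 0.
  elim: k z nil_z => [|k IHk] z.
    by move=> /= ->; rewrite !(mulmx0, mul0mx).
  rewrite iterSr => /IHk[]; rewrite lieB.
  rewrite (mulmxBl _ _ e) -(mulmxA z) ye mulmx0 subr0 !mulmxA yC -mulmxA => yze.
  rewrite (mulmxBr e) !mulmxA ey mul0mx sub0r mulNmx -(mulmxA (e *m z)) Cy.
  move=> /eqP; rewrite oppr_eq0 => /eqP ezy.
  split; first by rewrite cl -!mulmxA yze mulmx0.
  by rewrite cr mulmxA ezy mul0mx.
apply/eqP; rewrite -subr_eq0; apply/eqP.
transitivity (e *m z *m (1%:M - e) - (1%:M - e) *m (z *m e)); last first.
  by rewrite Ce eC subrr.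
by rewrite mulmxBr mulmxBl mulmx1 mul1mx mulmxA opprB addrA subrK.
Qed.

(** In the ordering of the entries by rows from the bottom up, and from left to
    right within a row, [ad x] is triangular with diagonal coefficients
    [x i i - x j j].  So a nonzero element of [W] with the most leading zeros
    is an eigenvector. *)
Lemma ad_trig_eigenvector x W :
    (forall i j : 'I_n, (j < i)%N -> x i j = 0) ->
    {in W, forall z, lie x z \in W} -> W != 0%VS ->
  exists2 z, z \in W & z != 0 /\ exists l : K, lie x z = l *: z.
Proof.
move=> trig_x adW W0.
pose pos (i j : 'I_n) := ((n - i) * n + j)%N.
have pos_bnd i j : (pos i j < n.+1 * n)%N.
  rewrite /pos mulSn addnC -addSn leq_add // ?ltn_ord //.
  by rewrite leq_mul2r leq_subr orbT.
suff: forall k z, z \in W -> z != 0 ->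
    (forall i j, (pos i j + k < n.+1 * n)%N -> z i j = 0) ->
    exists2 z, z \in W & z != 0 /\ exists l : K, lie x z = l *: z.
  have [z Wz z0] : exists2 z, z \in W & z != 0.
    by exists (vpick W); rewrite ?memv_pick ?vpick0.
  move/(_ (n.+1 * n)%N z Wz z0); apply=> i j.
  by rewrite -[X in (_ < X)%N]add0n ltn_add2r.
elim=> [|k IHk] z Wz z0 zpos.
  by case/eqP: z0; apply/matrixP=> i j; rewrite mxE zpos // addn0.
have z_diag i j : (pos i j + k < n.+1 * n)%N ->
    lie x z i j = (x i i - x j j) * z i j.
  move=> lt_ij; rewrite !mxE (bigD1 i) //=.
  rewrite (bigD1 j (F := fun t => z i t * _)) //=.
  rewrite !big1 ?addr0 ?mulrBl 1?[z i j * _]mulrC // => t.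
    case: (ltngtP j t) => [jt _||/val_inj->]; rewrite ?eqxx //.
      by rewrite trig_x ?mulr0.
    move=> tj _; rewrite zpos ?mul0r //; apply: leq_trans lt_ij.
    by rewrite ltnS addnS -addSn leq_add2r -addnS leq_add2l.
  case: (ltngtP i t) => [it _||/val_inj->]; rewrite ?eqxx //; last first.
    by move=> ti _; rewrite trig_x ?mul0r.
  rewrite zpos ?mulr0 //; apply: leq_trans lt_ij.
  rewrite ltnS addnS -addSn leq_add2r /pos.
  apply: (@leq_trans ((n - t).+1 * n)); first by rewrite mulSn addnC ltn_add2r.
  by apply: leq_trans (leq_addr _ _); rewrite leq_mul2r ltn_sub2l ?orbT.
have [/existsP[i0 /existsP[j0 /andP[/eqP pos0 _]]] | no_ij] :=
    boolP [exists i, exists j, (pos i j + k.+1 == n.+1 * n)%N && (z i j != 0)];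
  last first.
  apply: (IHk z) => // i j; rewrite leq_eqVlt -addnS => /orP[ij|/zpos//].
  apply/eqP; apply: contraNT no_ij => zij.
  by apply/existsP; exists i; apply/existsP; exists j; rewrite ij.
pose l := x i0 i0 - x j0 j0.
have [lz | w0] := eqVneq (lie x z - l *: z) 0.
  by exists z => //; split=> //; exists l; apply/eqP; rewrite -subr_eq0 lz.
apply: (IHk _ _ w0) => [|i j lt_ij]; first by rewrite rpredB ?rpredZ ?adW.
have -> : (lie x z - l *: z) i j = lie x z i j - l * z i j by rewrite !mxE.
rewrite z_diag // -mulrBl; apply/eqP; rewrite mulf_eq0 orbC.
have [//|zij /=] := eqVneq (z i j) 0.
have posE i' j' : edivn (pos i' j') n = ((n - i')%N, val j').
  by rewrite edivn_eq.
have eq_pos : pos i j = pos i0 j0.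
  apply/eqP; rewrite -(eqn_add2r k.+1) pos0 eqn_leq addnS lt_ij leqNgt /=.
  by apply: contra zij; rewrite -addnS => /zpos ->.
have := posE i j; rewrite eq_pos posE => -[eq_i eq_j].
have -> : j = j0 by apply: val_inj.
have -> : i = i0.
  apply: val_inj; apply/eqP.
  by rewrite -(eqn_sub2lE (ltnW (ltn_ord i)) (ltnW (ltn_ord i0))) eq_i.
by rewrite subrr.
Qed.
End AdNilpotent.

(** * Explicit 3 x 3 matrices *)

(** Matrix identities between explicit matrices become nine scalar identities,
    which are then in the reach of [ring] and [field]. *)
Definition mx3 (K : Type) (a b c d f g h k l : K) : 'M[K]_3 :=
  \matrix_(i, j)
    nth a (nth [::] [:: [:: a; b; c]; [:: d; f; g]; [:: h; k; l]] i) j.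

Lemma mx3E (K : Type) (z : 'M[K]_3) :
  z = mx3 (z 0 0) (z 0 1) (z 0 2%:R) (z 1 0) (z 1 1) (z 1 2%:R)
          (z 2%:R 0) (z 2%:R 1) (z 2%:R 2%:R).
Proof.
by apply/matrixP=> -[[|[|[|//]]] ?] [[|[|[|//]]] ?]; rewrite !mxE /=;
   congr (z _ _); apply: val_inj.
Qed.

Lemma mx3_surj (K : Type) (z : 'M[K]_3) :
  exists a b c d f g h k l, z = mx3 a b c d f g h k l.
Proof. do 9!eexists; exact: mx3E. Qed.

Lemma mx3_inj (K : Type) (a b c d f g h k l a' b' c' d' f' g' h' k' l' : K) :
  mx3 a b c d f g h k l = mx3 a' b' c' d' f' g' h' k' l' ->
  [/\ [/\ a = a', b = b' & c = c'], [/\ d = d', f = f' & g = g']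
    & [/\ h = h', k = k' & l = l']].
Proof.
move/matrixP=> eqM; split; split.
- by move: (eqM 0 0); rewrite !mxE.
- by move: (eqM 0 1); rewrite !mxE.
- by move: (eqM 0 2%:R); rewrite !mxE.
- by move: (eqM 1 0); rewrite !mxE.
- by move: (eqM 1 1); rewrite !mxE.
- by move: (eqM 1 2%:R); rewrite !mxE.
- by move: (eqM 2%:R 0); rewrite !mxE.
- by move: (eqM 2%:R 1); rewrite !mxE.
- by move: (eqM 2%:R 2%:R); rewrite !mxE.
Qed.

Section Mx3.
Variable K : fieldType.
Implicit Types s a b c d f g h k l : K.

Lemma mx3D a b c d f g h k l a' b' c' d' f' g' h' k' l' :
  mx3 a b c d f g h k l + mx3 a' b' c' d' f' g' h' k' l' =
  mx3 (a + a') (b + b') (c + c') (d + d') (f + f') (g + g')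
      (h + h') (k + k') (l + l').
Proof.
by apply/matrixP=> -[[|[|[|//]]] ?] [[|[|[|//]]] ?]; rewrite !mxE.
Qed.

Lemma mx3N a b c d f g h k l :
  - mx3 a b c d f g h k l =
  mx3 (- a) (- b) (- c) (- d) (- f) (- g) (- h) (- k) (- l).
Proof.
by apply/matrixP=> -[[|[|[|//]]] ?] [[|[|[|//]]] ?]; rewrite !mxE.
Qed.

Lemma mx3Z s a b c d f g h k l :
  s *: mx3 a b c d f g h k l =
  mx3 (s * a) (s * b) (s * c) (s * d) (s * f) (s * g) (s * h) (s * k) (s * l).
Proof.
by apply/matrixP=> -[[|[|[|//]]] ?] [[|[|[|//]]] ?]; rewrite !mxE.
Qed.

Lemma mx3M a b c d f g h k l a' b' c' d' f' g' h' k' l' :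
  mx3 a b c d f g h k l *m mx3 a' b' c' d' f' g' h' k' l' =
  mx3 (a * a' + b * d' + c * h') (a * b' + b * f' + c * k')
      (a * c' + b * g' + c * l')
      (d * a' + f * d' + g * h') (d * b' + f * f' + g * k')
      (d * c' + f * g' + g * l')
      (h * a' + k * d' + l * h') (h * b' + k * f' + l * k')
      (h * c' + k * g' + l * l').
Proof.
by apply/matrixP=> -[[|[|[|//]]] ?] [[|[|[|//]]] ?];
   rewrite !mxE !big_ord_recl big_ord0 !mxE /= addr0 addrA.
Qed.

Lemma mx30 : 0 = mx3 0 0 0 0 0 0 0 0 0 :> 'M[K]_3.
Proof. by apply/matrixP=> -[[|[|[|//]]] ?] [[|[|[|//]]] ?]; rewrite !mxE. Qed.

Lemma mx3s s : s%:M = mx3 s 0 0 0 s 0 0 0 s :> 'M[K]_3.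
Proof.
by apply/matrixP=> -[[|[|[|//]]] ?] [[|[|[|//]]] ?];
   rewrite !mxE ?mulr1n ?mulr0n.
Qed.

Lemma mx3_tr a b c d f g h k l : \tr (mx3 a b c d f g h k l) = a + f + l.
Proof. by rewrite /mxtrace !big_ord_recl big_ord0 !mxE /= addr0 addrA. Qed.

Definition mx3_simp := (mx30, mx3s, mx3D, mx3N, mx3Z, mx3M).

Lemma sl3mx_mx3 (l : nat -> K) :
  sl3mx l = mx3 (- l 5%N - l 8%N) (l 1%N) (l 2%N) (l 3%N) (l 5%N) (l 6%N)
                (l 4%N) (l 7%N) (l 8%N).
Proof. by apply/matrixP=> -[[|[|[|//]]] ?] [[|[|[|//]]] ?]; rewrite !mxE. Qed.

End Mx3.

(** The coefficients of the characteristic polynomial are expressed through the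
    power sums of the eigenvalues by Newton's identities. *)
Lemma Cayley_Hamilton_mx3 (K : numFieldType) (y : 'M[K]_3) :
  let t1 := \tr y in let t2 := \tr (y *m y) in let t3 := \tr (y *m y *m y) in
  y *m y *m y = t1 *: (y *m y) - ((t1 ^+ 2 - t2) / 2) *: y
    + ((t1 ^+ 3 - 3 * t1 * t2 + 2 * t3) / 6)%:M.
Proof.
have [a [b [c [d [f [g [h [k [l ->]]]]]]]]] := mx3_surj y.
rewrite /= !mx3_simp !mx3_tr.
by congr mx3; field.
Qed.

(** The powers [y], [y^2], [y^3] are again eigenvectors, with eigenvalues [l],
    [2 l], [3 l]; as brackets they have trace 0, so all eigenvalues of [y]
    vanish. *)
Lemma lie_eigen_nilpotent (K : numFieldType) (x y : 'M[K]_3) (l : K) : l != 0 ->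
  lie x y = l *: y -> y *m y *m y = 0.
Proof.
move=> l0 xy.
have xy2 := lie_eigenM xy xy; have xy3 := lie_eigenM xy2 xy.
have l20 : l + l != 0 by rewrite -mulr2n mulrn_eq0.
have l30 : l + l + l != 0 by rewrite -mulr2n -mulrSr mulrn_eq0.
rewrite Cayley_Hamilton_mx3 (mxtrace_lie_eigen l0 xy).
rewrite (mxtrace_lie_eigen l20 xy2) (mxtrace_lie_eigen l30 xy3).
rewrite !expr0n /= !(mul0r, mulr0, subr0, addr0, scale0r, raddf0).
reflexivity.
Qed.

(** A triangular matrix of trace 0 that is not nilpotent has a simple eigenvalue
    [l]: three equal eigenvalues would have to be 0, and three that are not all
    equal include one different from the others.  If [m] and [n] are these, the
    spectral projector of [l] is [(x - m) (x - n) / ((l - m) (l - n))]. *)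
Lemma upper_trig_idempotent (K : numFieldType) (x : 'M[K]_3) :
    (forall i j : 'I_3, (j < i)%N -> x i j = 0) -> \tr x = 0 ->
    x *m x *m x != 0 ->
  exists e : 'M[K]_3, [/\ e *m e = e, \tr e = 1 &
    forall k z, iter k (lie x) z = 0 -> e *m z = z *m e].
Proof.
move=> trig; have := mx3E x.
rewrite (trig 1 0) ?(trig 2%:R 0) ?(trig 2%:R 1) //.
move: (x 0 0) (x 0 1) (x 0 2%:R) (x 1 1) (x 1 2%:R) (x 2%:R 2%:R).
move=> a p q b r c {trig}->; rewrite mx3_tr; move/eqP.
rewrite addr_eq0 => /eqP eqc; set X := mx3 _ _ _ _ _ _ _ _ _ => X3.
pose e l m n := ((l - m) * (l - n))^-1 *: ((X - m%:M) *m (X - n%:M)).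
(* The inverse of [X - l] on the kernel of the projector, from the factorization
   of [(l - m) (l - n) - (X - m) (X - n)] by [X - l]. *)
pose g l m n := - ((l - m) * (l - n))^-1 *: (X + (l - m - n)%:M).
have build l m n : [\/ (l, m, n) = (a, b, c), (l, m, n) = (b, a, c)
      | (l, m, n) = (c, a, b)] -> l != m -> l != n ->
   exists e : 'M[K]_3, [/\ e *m e = e, \tr e = 1 &
    forall k z, iter k (lie X) z = 0 -> e *m z = z *m e].
  move=> lmn lm ln.
  have lmn0 : (l - n != 0) && (l - m != 0) by rewrite !subr_eq0 lm ln.
  have Xe : X *m e l m n = l *: e l m n.
    case: lmn lmn0 => -[-> -> ->] lmn0;
    by rewrite /e /X !mx3_simp; congr mx3; field.
  have eX : e l m n *m X = l *: e l m n.
    case: lmn lmn0 => -[-> -> ->] lmn0;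
    by rewrite /e /X !mx3_simp; congr mx3; field.
  have eg : 1%:M - e l m n = g l m n *m (X - l%:M).
    case: lmn lmn0 => -[-> -> ->] lmn0;
    by rewrite /e /g /X !mx3_simp; congr mx3; field.
  have ge : 1%:M - e l m n = (X - l%:M) *m g l m n.
    case: lmn lmn0 => -[-> -> ->] lmn0;
    by rewrite /e /g /X !mx3_simp; congr mx3; field.
  exists (e l m n); split=> [||k z].
  - apply/eqP; rewrite eq_sym -subr_eq0 -{1}[e l m n]mul1mx -mulmxBl eg.
    by rewrite -mulmxA mulmxBl Xe mul_scalar_mx subrr mulmx0.
  - case: lmn lmn0 => -[-> -> ->] lmn0;
    by rewrite /e /X !mx3_simp mx3_tr; field.
  - exact: idempotent_comm_of_ad_nilpotent Xe eX eg ge.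
have [eq_ab | ab] := eqVneq a b; last first.
  have [eq_ac | ac] := eqVneq a c; last first.
    by apply: (build a b c) => //; constructor.
  apply: (build b a c); rewrite 1?eq_sym //; first by constructor.
  by rewrite -eq_ac.
have [eq_ac | ac] := eqVneq a c; last first.
  by apply: (build c a b); rewrite -?eq_ab 1?eq_sym //; constructor.
case/eqP: X3; have a0 : a = 0.
  have /eqP : a *+ 3 = 0.
    by rewrite mulrSr mulr2n {2}eq_ab eqc eq_ac addNr.
  by rewrite mulrn_eq0 => /eqP.
by rewrite /X -eq_ab -eq_ac a0 !mx3_simp; congr mx3; ring.
Qed.

(** * The standard pair *)

Lemma dim_sl (K : fieldType) n : \dim (sl K n.+1) = (n.+1 * n.+1).-1.
Proof.
have := limg_ker_dim (linfun (@mxtrace K n.+1 : _ -> K^o)) fullv.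
rewrite capfv -/(sl K n.+1) dimvf => eq_dim.
suff dim1 : \dim (limg (linfun (@mxtrace K n.+1 : _ -> K^o))) = 1%N.
  by rewrite dim1 addn1 in eq_dim; rewrite -[LHS]/(_.+1.-1) eq_dim.
apply/eqP; rewrite eqn_leq; apply/andP; split.
  by rewrite (leq_trans (dimvS (subvf _))) ?dimvf.
rewrite lt0n dimv_eq0; apply/eqP=> lim0.
have : linfun (@mxtrace K n.+1 : _ -> K^o) (delta_mx 0 0) \in
    limg (linfun (@mxtrace K n.+1 : _ -> K^o)) by rewrite memv_img ?memvf.
rewrite lim0 memv0 lfunE /= /mxtrace big_ord_recl mxE big1 => [|i _].
  by rewrite addr0 oner_eq0.
by rewrite mxE.
Qed.

Lemma memv_span4 (K : fieldType) (vT : vectType K) (x1 x2 x3 x4 z : vT) :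
  reflect (exists a b c d, z = a *: x1 + b *: x2 + c *: x3 + d *: x4)
    (z \in <<[:: x1; x2; x3; x4]>>%VS).
Proof.
apply: (iffP idP) => [|[a [b [c [d ->]]]]].
  rewrite !span_cons span_nil addv0.
  case/memv_addP=> y1 /vlineP[a ->] [z1 /memv_addP[y2 /vlineP[b ->]]].
  case=> z2 /memv_addP[y3 /vlineP[c ->] [y4 /vlineP[d ->] ->]] -> ->.
  by exists a, b, c, d; rewrite !addrA.
by rewrite !rpredD ?rpredZ ?memv_span // !inE eqxx ?orbT.
Qed.

Section Standard.
Variable K : fieldType.
Implicit Types a b c d f g h k l : K.

Definition gl2 : {vspace 'M[K]_3} := <<[:: e K 5; e K 6; e K 7; e K 8]>>%VS.
Definition offdiag : {vspace 'M[K]_3} := <<[:: e K 1; e K 2; e K 3; e K 4]>>%VS.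

Lemma gl2P z :
  reflect (exists f g k l, z = mx3 (- f - l) 0 0 0 f g 0 k l) (z \in gl2).
Proof.
apply: (iffP (memv_span4 _ _ _ _ _)) => -[f [g [k [l ->]]]];
  exists f, g, k, l; rewrite /e !sl3mx_mx3 /= !mx3_simp; congr mx3; ring.
Qed.

Lemma offdiagP z :
  reflect (exists b c d h, z = mx3 0 b c d 0 0 h 0 0) (z \in offdiag).
Proof.
apply: (iffP (memv_span4 _ _ _ _ _)) => -[f [g [k [l ->]]]];
  exists f, g, k, l; rewrite /e !sl3mx_mx3 /= !mx3_simp; congr mx3; ring.
Qed.

Lemma reductive_pair_gl2 : reductive_pair (sl K 3) gl2 offdiag.
Proof.
split; first split.
- apply/subvP=> _ /gl2P[f [g [k [l ->]]]]; rewrite mem_sl mx3_tr.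
  by apply/eqP; ring.
- move=> _ _ /gl2P[f [g [k [l ->]]]] /gl2P[f' [g' [k' [l' ->]]]]; apply/gl2P.
  do 4!eexists; rewrite /lie !mx3_simp; congr mx3; try reflexivity; ring.
- apply/directv_addP/eqP; rewrite -subv0; apply/subvP=> z.
  rewrite memv_cap memv0 => /andP[/offdiagP[b [c [d [h ->]]]]].
  case/gl2P=> f [g [k [l eqz]]].
  have [[_ -> ->] [-> _ _] [-> _ _]] := mx3_inj eqz.
  by rewrite mx30.
- apply/eqP; rewrite eqEsubv; apply/andP; split.
    rewrite subv_add; apply/andP; split; apply/subvP=> z.
      by case/offdiagP=> [b [c [d [h ->]]]]; rewrite mem_sl mx3_tr !addr0.
    case/gl2P=> [f [g [k [l ->]]]]; rewrite mem_sl mx3_tr.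
    by apply/eqP; ring.
  apply/subvP=> z; have [a [b [c [d [f [g [h [k [l ->]]]]]]]]] := mx3_surj z.
  rewrite mem_sl mx3_tr -addrA addr_eq0 => /eqP->.
  apply/memv_addP; exists (mx3 0 b c d 0 0 h 0 0).
    by apply/offdiagP; exists b, c, d, h.
  exists (mx3 (- f - l) 0 0 0 f g 0 k l).
    by apply/gl2P; exists f, g, k, l.
  by rewrite mx3D; congr mx3; ring.
move=> _ _ /gl2P[f [g [k [l ->]]]] /offdiagP[b [c [d [h ->]]]]; apply/offdiagP.
do 4!eexists; rewrite /lie !mx3_simp; congr mx3; try reflexivity; ring.
Qed.

Lemma dim_reductive_pair (n : nat) (h m : {vspace 'M[K]_n.+1}) :
  reductive_pair (sl K n.+1) h m -> (\dim m + \dim h = (n.+1 * n.+1).-1)%N.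
Proof.
by case=> _ /directv_addP dir mh _; rewrite -dimv_disjoint_sum // mh dim_sl.
Qed.

(** Both spaces have four generators and their dimensions add up to 8. *)
Lemma dim_gl2 : \dim gl2 = 4%N.
Proof.
have := dim_reductive_pair reductive_pair_gl2.
have : (\dim offdiag <= 4)%N by apply: dim_span.
have : (\dim gl2 <= 4)%N by apply: dim_span.
by move: (\dim gl2) (\dim offdiag) => [|[|[|[|[|?]]]]] // [|[|[|[|[|?]]]]].
Qed.

Lemma offdiag_generates : lie_generates (sl K 3) offdiag.
Proof.
move=> k [ksl klie] /subvP mk; apply/eqP; rewrite eqEsubv ksl /=.
have [_ _ <- _] := reductive_pair_gl2; rewrite subv_add; apply/andP; split.
  exact/subvP.
have off i : i \in [:: 1; 2; 3; 4]%N -> e K i \in k.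
  rewrite !inE => i4; apply/mk/memv_span.
  by rewrite !inE; case/or4P: i4 => /eqP->; rewrite eqxx ?orbT.
have lie_off i j : i \in [:: 1; 2; 3; 4]%N -> j \in [:: 1; 2; 3; 4]%N ->
  lie (e K i) (e K j) \in k by move=> ? ?; rewrite klie ?off.
apply/span_subvP=> x; rewrite !inE => /or4P[]/eqP->.
- suff <- : lie (e K 3) (e K 1) = e K 5 by rewrite lie_off.
  by rewrite /lie /e !sl3mx_mx3 /= !mx3_simp; congr mx3; ring.
- suff <- : lie (e K 3) (e K 2) = e K 6 by rewrite lie_off.
  by rewrite /lie /e !sl3mx_mx3 /= !mx3_simp; congr mx3; ring.
- suff <- : lie (e K 4) (e K 1) = e K 7 by rewrite lie_off.
  by rewrite /lie /e !sl3mx_mx3 /= !mx3_simp; congr mx3; ring.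
suff <- : lie (e K 4) (e K 2) = e K 8 by rewrite lie_off.
by rewrite /lie /e !sl3mx_mx3 /= !mx3_simp; congr mx3; ring.
Qed.

(** An element of [gl2] is determined by its lower right 2 x 2 block, which is
    arbitrary. *)
Lemma gl2_isomorphic : lie_isomorphic gl2 (gl K 2).
Proof.
pose block : 'Hom('M[K]_3, 'M[K]_2) :=
  linfun (mxsub (@rshift 1 2) (@rshift 1 2)).
have blockE (z : 'M[K]_3) i j : block z i j = z (rshift 1 i) (rshift 1 j).
  by rewrite lfunE /= mxE.
exists block; split.
- apply/eqP; rewrite eqEsubv subvf /=; apply/subvP=> w _.
  apply/memv_imgP.
  exists (mx3 (- w 0 0 - w 1 1) 0 0 0 (w 0 0) (w 0 1) 0 (w 1 0) (w 1 1)).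
    by apply/gl2P; do 4!eexists.
  apply/matrixP=> i j; rewrite blockE mxE.
  by case: i j => [[|[|//]] ?] [[|[|//]] ?] /=; congr (w _ _); apply: val_inj.
- move=> _ _ /gl2P[f [g [k [l ->]]]] /gl2P[f' [g' [k' [l' ->]]]] /matrixP eqw.
  have [] := (eqw 0 0, eqw 0 1); rewrite !blockE !mxE /= => -> ->.
  by have [] := (eqw 1 0, eqw 1 1); rewrite !blockE !mxE /= => -> ->.
move=> _ _ /gl2P[f [g [k [l ->]]]] /gl2P[f' [g' [k' [l' ->]]]].
apply/matrixP=> i j; rewrite blockE /lie !mx3_simp !mxE.
rewrite !big_ord_recl !big_ord0 !blockE !mxE.
by case: i j => [[|[|//]] ?] [[|[|//]] ?] /=; ring.
Qed.

End Standard.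

(** * Normal forms of rank one matrices *)

Section Rank.
Variables (K : fieldType) (n : nat).

Lemma mxtrace_idempotent (e : 'M[K]_n) : e *m e = e -> \tr e = (\rank e)%:R.
Proof.
move=> ee; suff ba : row_base e *m col_base e = 1%:M.
  by rewrite -{1}(mulmx_base e) mxtrace_mulC ba mxtrace1.
apply: (row_full_inj (col_base_full e)).
apply: (row_free_inj (row_base_free e)).
by rewrite mulmx1 mulmx_base mulmxA mulmx_base -mulmxA mulmx_base.
Qed.

Lemma kermx_basis (e : 'M[K]_n) k : (\rank e + k = n)%N ->
  exists B : 'M[K]_(k, n), row_free B /\ B *m e = 0.
Proof.
move=> rk; have: \rank (kermx e) = k by rewrite mxrank_ker -{1}rk addKn.
have: exists B : 'M[K]_(\rank (kermx e), n), row_free B /\ B *m e = 0.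
  exists (row_base (kermx e)); split; first exact: row_base_free.
  by apply/sub_kermxP; rewrite eq_row_base.
by move=> exB <-.
Qed.

Lemma row_free_ker_ext (e : 'M[K]_n) k (w : 'rV_n) (B : 'M[K]_(k, n)) :
  row_free B -> B *m e = 0 -> w *m e != 0 -> row_free (col_mx w B).
Proof.
move=> Bfree Be we; rewrite -kermx_eq0; apply/rowV0P=> v /sub_kermxP.
rewrite -[v]hsubmxK mul_row_col => eq0.
have vl : lsubmx v = 0.
  have /eqP : lsubmx v *m w *m e = 0.
    have := congr1 (mulmxr e) eq0.
    by rewrite /= mulmxDl -(mulmxA _ B) Be mulmx0 addr0 mul0mx.
  rewrite [lsubmx v]mx11_scalar mul_scalar_mx -scalemxAl scalemx_eq0.
  by rewrite (negPf we) orbF => /eqP->; rewrite raddf0.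
rewrite vl mul0mx add0r in eq0 *.
by rewrite (row_free_inj Bfree (etrans eq0 (esym (mul0mx _ B)))) row_mx0.
Qed.

Lemma exists_row_neq0 (A : 'M[K]_n) : A != 0 -> exists i, row i A != 0.
Proof.
move=> A0; apply/existsP; apply: contraNT A0.
rewrite negb_exists => /forallP row0.
by apply/eqP/row_matrixP=> i; rewrite linear0; apply/eqP/negbNE.
Qed.

Lemma mulmx_delta_mulmx (A : 'M[K]_n) i j k l :
  (A *m delta_mx i j *m A) k l = A k i * A j l.
Proof.
rewrite -(mul_delta_mx (0 : 'I_1)) mulmxA -mulmxA -colE -rowE mxE big_ord1.
by rewrite !mxE.
Qed.

End Rank.

Lemma delta_mx_mul_col (K : fieldType) n (k : 'I_(1 + n)) (a : 'M[K]_(1 + n)) :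
  (delta_mx (lshift n 0) k : 'M_(1 + n)) *m a = col_mx (row k a) 0.
Proof.
apply/row_matrixP=> i; rewrite row_mul rowE mul_delta_mx_cond.
case: (split_ordP i) => j ->; rewrite ?rowKu ?rowKd.
  by rewrite (ord1 j) eqxx mulr1n -rowE row_id.
by rewrite eq_rlshift mulr0n mul0mx linear0.
Qed.

Section Sl3.
Variable K : numFieldType.
Implicit Types (h m : {vspace 'M[K]_3}).

Let E11 : 'M[K]_3 := mx3 1 0 0 0 0 0 0 0 0.
Let E13 : 'M[K]_3 := mx3 0 0 1 0 0 0 0 0 0.
Let E22 : 'M[K]_3 := mx3 0 0 0 0 1 0 0 0 0.
Let E31 : 'M[K]_3 := mx3 0 0 0 0 0 0 1 0 0.
Let D : 'M[K]_3 := mx3 1 0 0 0 0 0 0 0 (-1).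

Lemma det_mx3_diag (s : K) : \det (mx3 s 0 0 0 1 0 0 0 1) = s.
Proof.
rewrite det_trig; first by rewrite !big_ord_recl big_ord0 !mxE /= !mulr1.
by apply/is_trig_mxP=> -[[|[|[|//]]] ?] [[|[|[|//]]] ?]; rewrite !mxE.
Qed.

(** The rows of [a] are a basis of eigenvectors of [e] acting on the right; the
    first one is rescaled to reach determinant 1. *)
Lemma idempotent_conj (e : 'M[K]_3) : e *m e = e -> \tr e = 1 ->
  exists2 a, \det a = 1 & a *m e = E11 *m a.
Proof.
move=> ee tre; have rke : \rank e = 1%N.
  by apply/eqP; rewrite -(@eqr_nat K) -mxtrace_idempotent // tre.
have [B [Bfree Be]] := @kermx_basis K 3 e 2 (congr1 (addn^~ 2) rke).
have [i rowi] : exists i, row i e != 0.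
  by apply: exists_row_neq0; rewrite -mxrank_eq0 rke.
have pe : row i e *m e = row i e by rewrite -row_mul ee.
pose a : 'M[K]_3 := col_mx (row i e) B.
have ua : a \in unitmx.
  by rewrite -row_free_unit (row_free_ker_ext Bfree Be) ?pe.
have ae : a *m e = E11 *m a.
  have -> : E11 = delta_mx (lshift 2 0) (lshift 2 0) :> 'M_(1 + 2).
    by apply/matrixP=> -[[|[|[|//]]] ?] [[|[|[|//]]] ?]; rewrite !mxE.
  rewrite delta_mx_mul_col; apply: etrans (mul_col_mx (row i e) B e) _.
  by rewrite pe Be /a rowKu row_id.
pose d : 'M[K]_3 := mx3 (\det a)^-1 0 0 0 1 0 0 0 1.
exists (d *m a).
  by rewrite det_mulmx det_mx3_diag mulVf // -unitfE -unitmxE.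
rewrite -mulmxA ae !mulmxA; congr (_ *m _); rewrite !mx3M; congr mx3; ring.
Qed.

(** Here [y] has rank 1 and [e_i y] is nonzero for some basis row [e_i].  The
    rows [e_i], [t], [e_i y], where [t] and [e_i y] span the kernel, form a
    Jordan basis of [y]. *)
Lemma sq0_conj (y : 'M[K]_3) : y *m y = 0 -> y != 0 ->
  exists2 a, a \in unitmx & a *m y = E13 *m a.
Proof.
move=> yy y0; have rky : \rank y = 1%N.
  have := mulmx0_rank_max yy; have : \rank y != 0%N by rewrite mxrank_eq0.
  lia.
have [B [Bfree By]] := @kermx_basis K 3 y 2 (congr1 (addn^~ 2) rky).
have [i rowi] := exists_row_neq0 y0.
have wy : (delta_mx 0 i : 'rV_3) *m y != 0 by rewrite -rowE.
have py : row i y *m y = 0 by rewrite -row_mul yy linear0.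
have pfree : row_free (row i y) by rewrite /row_free rank_rV rowi.
have [j rowj] : exists j, ~~ (row j B <= row i y)%MS.
  apply/row_subPn/negP => /mxrankS; rewrite (eqP Bfree) rank_rV.
  by case: (_ != 0).
have tfree : row_free (col_mx (row j B) (row i y)).
  by apply: (row_free_ker_ext pfree (mulmx_coker _)); rewrite -submxE.
have ty : col_mx (row j B) (row i y) *m y = 0.
  by rewrite mul_col_mx py -row_mul By linear0 col_mx0.
pose a : 'M[K]_3 := col_mx (delta_mx 0 i : 'rV_3) (col_mx (row j B) (row i y)).
exists a; first by rewrite -row_free_unit (row_free_ker_ext tfree ty wy).
have -> : E13 = delta_mx (lshift 2 0) (rshift 1 (rshift 1 0))
    :> 'M_(1 + (1 + 1)).
  by apply/matrixP=> -[[|[|[|//]]] ?] [[|[|[|//]]] ?]; rewrite !mxE.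
rewrite delta_mx_mul_col.
apply: etrans (mul_col_mx (delta_mx 0 i : 'rV_3)
  (col_mx (row j B) (row i y)) y) _.
by rewrite ty -rowE /a rowKd (rowKd 0 (row j B)) row_id.
Qed.

(** * From a commuting idempotent to the standard pair *)

(** Conjugation takes [h] into the centralizer of E11 and hence onto [gl2] by
    dimension.  For [H := diag(-2, 1, 1)] the map [(ad H)^2] is 9 times the
    projection onto [offdiag] along [gl2]; it preserves the conjugate of [m],
    which meets [gl2] trivially and so lies in [offdiag]. *)
Lemma reductive_pair_idempotent h m (e : 'M[K]_3) :
    reductive_pair (sl K 3) h m -> \dim h = 4%N ->
    e *m e = e -> \tr e = 1 -> {in h, forall z, e *m z = z *m e} ->
  exists a : 'M[K]_3,
    [/\ \det a = 1, (Ad a @: h)%VS = gl2 K & (Ad a @: m)%VS = offdiag K].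
Proof.
move=> red dimh ee tre comm; have [a deta ae] := idempotent_conj ee tre.
have ua : a \in unitmx by rewrite unitmxE deta unitr1.
exists a; have red' := reductive_pair_Ad ua red.
have h0 : (Ad a @: h)%VS = gl2 K.
  apply/eqP; rewrite eqEdim dim_Ad // dimh dim_gl2 leqnn andbT.
  apply/subvP=> z /[dup] /memv_imgP[x hx ->] Az.
  have [[/subvP sub _] _ _ _] := red'; have := sub _ Az.
  have : E11 *m Ad a x = Ad a x *m E11.
    rewrite AdE -[E11](mulmxK ua) -ae !mulmxA !(mulmxKV ua).
    by rewrite -!(mulmxA a) comm.
  have [b11 [b [c [d [f [g [h' [k [l ->]]]]]]]]] := mx3_surj (Ad a x).
  rewrite /E11 !mx3M => eqM.
  have [[_ eqb eqc] [eqd _ _] [eqh _ _]] := mx3_inj eqM.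
  rewrite mem_sl mx3_tr => /eqP trz; apply/gl2P; exists f, g, k, l.
  move: eqb eqc eqd eqh; rewrite !(mul1r, mul0r, mulr0, mulr1, addr0, add0r).
  move=> -> -> <- <-; congr mx3; rewrite -[b11]subr0 -trz; ring.
split=> //; rewrite {}h0 in red'; move: (Ad a @: m)%VS red' => m' red'.
have dimm : \dim m' = \dim (offdiag K).
  apply/eqP; rewrite -(eqn_add2r (\dim (gl2 K))).
  rewrite (dim_reductive_pair red').
  by rewrite (dim_reductive_pair (reductive_pair_gl2 K)).
apply/eqP; rewrite eqEdim dimm leqnn andbT; apply/subvP=> z mz.
have [[hsl _] dir mh hm] := red'.
have : z \in sl K 3 by rewrite -mh; apply: (subvP (addvSl m' (gl2 K))).
have [_ _ <- _] := reductive_pair_gl2 K.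
case/memv_addP=> u /[dup] offu /offdiagP[b [c [d [h' equ]]]] [v hv eqz].
pose H : 'M[K]_3 := mx3 (- 2) 0 0 0 1 0 0 0 1.
have hH : H \in gl2 K.
  by apply/gl2P; exists 1, 0, 0, 1; congr mx3; ring.
have : lie H (lie H z) \in m' by rewrite !hm.
have -> : lie H (lie H z) = 9 *: u.
  case/gl2P: hv eqz => [f [g [k [l ->]]]] ->.
  by rewrite equ /lie /H !mx3_simp; congr mx3; ring.
rewrite rpredZeq pnatr_eq0 /= => mu.
have : v \in (m' :&: gl2 K)%VS.
  by rewrite memv_cap hv andbT -(addKr u v) -eqz rpredD ?rpredN.
by rewrite (directv_addP dir) memv0 => /eqP v0; rewrite eqz v0 addr0.
Qed.

(** * Nilpotent elements of the subalgebra *)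

(** Since [h] and [m] both have dimension 4, the nilpotent map [ad y] has fourth
    power 0 on each of them, hence on sl_3.  So [y^2 z y^2 = 0] for all [z] of
    trace 0. *)
Lemma nilpotent_sq0 h m y :
  reductive_pair (sl K 3) h m -> \dim h = 4%N -> y \in h ->
  y *m y *m y = 0 -> y *m y = 0.
Proof.
move=> red dimh hy y3.
have dimm : \dim m = 4%N.
  have := dim_reductive_pair red; rewrite dimh => /eqP.
  by rewrite (eqn_add2r 4 _ 4) => /eqP.
have [[hsl hlie] _ mh hm] := red.
have qq0 : y *m y *m (y *m y) = 0 by rewrite mulmxA y3 mul0mx.
have nil4 (W : {vspace 'M[K]_3}) : \dim W = 4%N ->
    {in W, forall z, lie y z \in W} -> {in W, forall z, iter 4 (lie y) z = 0}.
  move=> dimW Wlie z Wz; rewrite -iter_adE -dimW.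
  apply: nilpotent_iter_dim Wz => //.
    by apply/subvP=> _ /memv_imgP[w Ww ->]; rewrite adE Wlie.
  by move=> w _; rewrite iter_adE; apply: lie5_eq0 y3.
have nil z : z \in sl K 3 -> y *m y *m z *m (y *m y) = 0.
  rewrite -mh => /memv_addP[u mu [v hv ->]].
  have nilW w : iter 4 (lie y) w = 0 -> y *m y *m w *m (y *m y) = 0.
    by rewrite lie4_sq // => /eqP; rewrite scaler_eq0 pnatr_eq0 => /eqP.
  rewrite mulmxDr mulmxDl !nilW ?addr0 //.
    by apply: (nil4 h) => // ? ?; apply: hlie.
  by apply: (nil4 m) => // ? ?; apply: hm.
apply/matrixP=> i j; rewrite [RHS]mxE; apply/eqP; apply/negPn/negP => yij.
(* Subtracting a scalar to reach trace 0 is harmless, because [y^4 = 0]. *)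
pose z := delta_mx j i - ((\tr (delta_mx j i : 'M[K]_3)) / 3)%:M.
have /nil : z \in sl K 3.
  rewrite mem_sl /z linearB /= mxtrace_scalar -[X in _ - X]mulr_natr.
  by rewrite divfK ?subrr ?pnatr_eq0.
rewrite /z mulmxBr mulmxBl mul_mx_scalar -scalemxAl qq0 scaler0 subr0.
move/matrixP/(_ i j)/eqP; rewrite mulmx_delta_mulmx [X in _ == X]mxE.
by rewrite mulf_eq0 (negPf yij).
Qed.

(** For the grading of sl_3 by [ad D], with weights from -2 to 2, the space [h]
    is graded and contains E13, [D] and the weight -2 part E31 of [f].  Between
    the weights 1 and -1, [ad E31] and [ad E13] are mutually inverse; so if one
    of these parts of [h] were nonzero then both would be, and [\dim h >= 5].
    Hence [h] has even weights only, which means that it commutes with E22. *)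
Lemma sl2_triple_comm_E22 h : lie_subalgebra (sl K 3) h -> \dim h = 4%N ->
    E13 \in h -> D \in h -> (exists2 f, f \in h & f 2%:R 0 = 1) ->
  {in h, forall z, E22 *m z = z *m E22}.
Proof.
move=> [_ hlie] dimh h13 hD [f hf f31].
pose T w z := lie D z - w *: z.
have hT w z : z \in h -> T w z \in h by move=> hz; rewrite rpredB ?rpredZ ?hlie.
have TE w (a b c d f' g h' k l : K) : T w (mx3 a b c d f' g h' k l) =
    mx3 (- w * a) ((1 - w) * b) ((2 - w) * c) ((- 1 - w) * d) (- w * f')
      ((1 - w) * g) ((- 2 - w) * h') ((- 1 - w) * k) (- w * l).
  by rewrite /T /lie /D !mx3_simp; congr mx3; ring.
(* Applying [ad D - w] for all weights [w] but one isolates the part of that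
   weight, up to a nonzero integer factor. *)
have h31 : E31 \in h.
  have := hT 2 _ (hT 1 _ (hT 0 _ (hT (-1) _ hf))).
  rewrite (mx3E f) f31 !TE; set X := (X in X \in h).
  have -> : X = 24 *: E31 by rewrite /X /E31 mx3Z; congr mx3; ring.
  by rewrite rpredZeq pnatr_eq0.
have indep (b g d k : K) :
    mx3 0 b 0 0 0 g 0 0 0 \in h -> mx3 0 0 0 d 0 0 0 k 0 \in h ->
    (b != 0) || (g != 0) -> (d != 0) || (k != 0) -> False.
  move=> hu hv bg dk.
  pose X := [tuple E13; D; E31; mx3 0 b 0 0 0 g 0 0 0; mx3 0 0 0 d 0 0 0 k 0].
  have Xh : (<<X>> <= h)%VS.
    by apply/span_subvP=> x; rewrite !inE => /or4P[|||/orP[]] /eqP->.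
  suff : free X by move/eqP=> dimX; have := dimvS Xh; rewrite dimX dimh.
  apply/freeP=> c; rewrite !big_ord_recl big_ord0 /= mx30 !mx3_simp => eq0.
  have {eq0} := mx3_inj eq0; rewrite !(mulr0, mulr1, addr0, add0r).
  case=> [[c1 c3b c0] [c4d _ c3g] [c2 c4k _]].
  have c3 : c (lift ord0 (lift ord0 (lift ord0 ord0))) = 0.
    by case/orP: bg => /negPf nz; apply/eqP; move/eqP: c3b; move/eqP: c3g;
       rewrite !mulf_eq0 nz ?orbF.
  have c4 : c (lift ord0 (lift ord0 (lift ord0 (lift ord0 ord0)))) = 0.
    by case/orP: dk => /negPf nz; apply/eqP; move/eqP: c4d; move/eqP: c4k;
       rewrite !mulf_eq0 nz ?orbF.
  case=> -[|[|[|[|[|//]]]]] lti; [apply: etrans c0 | apply: etrans c1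
    | apply: etrans c2 | apply: etrans c3 | apply: etrans c4];
  by congr (c _); apply: val_inj.
move=> z; have [a [b [c [d [f' [g [h' [k [l ->]]]]]]]]] := mx3_surj z.
move=> hz.
have hu : mx3 0 b 0 0 0 g 0 0 0 \in h.
  have := hT 2 _ (hT 0 _ (hT (-1) _ (hT (-2) _ hz))).
  rewrite !TE; set X := (X in X \in h).
  have -> : X = - 6 *: mx3 0 b 0 0 0 g 0 0 0.
    by rewrite /X mx3Z; congr mx3; ring.
  by rewrite rpredZeq oppr_eq0 pnatr_eq0.
have hv : mx3 0 0 0 d 0 0 0 k 0 \in h.
  have := hT 2 _ (hT 0 _ (hT 1 _ (hT (-2) _ hz))).
  rewrite !TE; set X := (X in X \in h).
  have -> : X = - 6 *: mx3 0 0 0 d 0 0 0 k 0.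
    by rewrite /X mx3Z; congr mx3; ring.
  by rewrite rpredZeq oppr_eq0 pnatr_eq0.
have hu' : mx3 0 0 0 (- g) 0 0 0 b 0 \in h.
  have := hlie _ _ h31 hu; rewrite /lie /E31 !mx3_simp; set X := (X in X \in h).
  by suff -> : X = mx3 0 0 0 (- g) 0 0 0 b 0; [| rewrite /X; congr mx3; ring].
have hv' : mx3 0 k 0 0 0 (- d) 0 0 0 \in h.
  have := hlie _ _ h13 hv; rewrite /lie /E13 !mx3_simp; set X := (X in X \in h).
  by suff -> : X = mx3 0 k 0 0 0 (- d) 0 0 0; [| rewrite /X; congr mx3; ring].
have [b0 g0] : b = 0 /\ g = 0.
  have [-> | b0] := eqVneq b 0; have [-> // | g0] := eqVneq g 0;
  by case: (indep _ _ _ _ hu hu'); rewrite ?oppr_eq0 ?b0 ?g0 ?orbT.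
have [d0 k0] : d = 0 /\ k = 0.
  have [-> | d0] := eqVneq d 0; have [-> // | k0] := eqVneq k 0;
  by case: (indep _ _ _ _ hv' hv); rewrite ?oppr_eq0 ?d0 ?k0 ?orbT.
by rewrite b0 g0 d0 k0 !mx3_simp; congr mx3; ring.
Qed.

Lemma lie_lie_E13 f : lie E13 (lie E13 f) = - 2 *: E13 -> f 2%:R 0 = 1.
Proof.
have [a [b [c [d [f' [g [h' [k [l ->]]]]]]]]] := mx3_surj f.
rewrite /lie /E13 !mx3_simp mxE /= => eqM; have [[_ _ eq_c] _ _] := mx3_inj eqM.
apply: (@mulfI _ (- 2)); first by rewrite oppr_eq0 pnatr_eq0.
by rewrite -eq_c; ring.
Qed.

(** After conjugating [y] to E13, let [f] be the component of E31 in [h]; it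
    satisfies the same relation [[y, [y, f]] = -2 y] as E31 because [ad y]
    preserves [h] and [m].  Then [[y, f]] is an upper triangular matrix with
    diagonal [(1, 0, -1)], and a unipotent [b] commuting with E13 makes it
    diagonal. *)
Lemma nilpotent_idempotent h m y :
    reductive_pair (sl K 3) h m -> \dim h = 4%N ->
    y \in h -> y != 0 -> y *m y *m y = 0 ->
  exists e : 'M[K]_3, [/\ e *m e = e, \tr e = 1 &
    {in h, forall z, e *m z = z *m e}].
Proof.
move=> red dimh hy y0 y3.
have [a ua ay] := sq0_conj (nilpotent_sq0 red dimh hy y3) y0.
have [f hf lief] : exists2 f, f \in (Ad a @: h)%VS &
    lie E13 (lie E13 f) = - 2 *: E13.
  have h13 : E13 \in (Ad a @: h)%VS by rewrite -(Ad_eq ua ay) memv_img.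
  have [[hsl hlie] dir mh hm] := reductive_pair_Ad ua red.
  have : E31 \in sl K 3 by rewrite mem_sl mx3_tr !addr0.
  rewrite -mh => /memv_addP[u mu [v hv eq31]].
  have lie31 : lie E13 (lie E13 E31) = - 2 *: E13.
    by rewrite /lie /E13 /E31 !mx3_simp; congr mx3; ring.
  exists v => //; apply/eqP; rewrite -subr_eq0 -memv0 -(directv_addP dir).
  rewrite memv_cap andbC rpredB ?rpredZ ?hlie //=.
  suff -> : lie E13 (lie E13 v) - (- 2) *: E13 = - lie E13 (lie E13 u).
    by rewrite rpredN !hm.
  rewrite -lie31 eq31 -!adE (linearD (ad E13) u v) (linearD (ad E13)) opprD.
  by rewrite addrA addrAC subrr sub0r.
have f20 := lie_lie_E13 lief.
(* The rows of [b] are left eigenvectors of [[E13, f]] for 1, 0, -1. *)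
pose c := (f 2%:R 2%:R - f 0 0 - f 2%:R 1 * f 1 0) / 2.
pose b : 'M[K]_3 := mx3 1 (f 2%:R 1) c 0 1 (- f 1 0) 0 0 1.
have ub : b \in unitmx.
  pose b' : 'M[K]_3 :=
    mx3 1 (- f 2%:R 1) (- f 2%:R 1 * f 1 0 - c) 0 1 (f 1 0) 0 0 1.
  suff /mulmx1_unit[] : b *m b' = 1%:M by [].
  by rewrite !mx3_simp; congr mx3; ring.
have b13 : b *m E13 = E13 *m b by rewrite !mx3_simp; congr mx3; ring.
have bD : b *m lie E13 f = D *m b.
  rewrite /b /c (mx3E f) f20 /lie !mx3_simp !mxE /=.
  by congr mx3; field.
have [p pE] : exists p, p = b *m a by eexists.
have up : p \in unitmx by rewrite pE unitmx_mul ub.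
have [hsub _ _ _] := reductive_pair_Ad up red; have [_ hlie] := hsub.
have h13 : E13 \in (Ad p @: h)%VS.
  rewrite -(Ad_eq up (_ : p *m y = E13 *m p)) ?memv_img //.
  by rewrite pE -mulmxA ay !mulmxA b13.
have hf' : Ad b f \in (Ad p @: h)%VS by rewrite pE Ad_mul // memv_img.
have bE13 := Ad_eq ub b13.
have hD : D \in (Ad p @: h)%VS by rewrite -(Ad_eq ub bD) Ad_lie // bE13 hlie.
have comm22 : {in (Ad p @: h)%VS, forall z, E22 *m z = z *m E22}.
  apply: sl2_triple_comm_E22 => //; first by rewrite dim_Ad.
  exists (Ad b f) => //; apply: lie_lie_E13.
  by rewrite -bE13 -!Ad_lie // lief linearZ.
exists (invmx p *m E22 *m p); split.
- rewrite !mulmxA (mulmxK up) -(mulmxA (invmx p) E22 E22).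
  by rewrite [E22 *m E22]mx3M !(mulr0, mulr1, mul0r, addr0, add0r).
- by rewrite mxtrace_mulC mulmxA (mulmxV up) mul1mx mx3_tr !addr0 add0r.
move=> z hz; have := comm22 _ (memv_img (Ad p) hz).
have pz : p *m z = Ad p z *m p by rewrite AdE mulmxKV.
have zp : z *m invmx p = invmx p *m Ad p z.
  by rewrite AdE !mulmxA mulVmx ?mul1mx.
move: (Ad p z) => X in pz zp * => comm.
rewrite -(mulmxA _ p) pz (mulmxA z) (mulmxA z) zp !mulmxA.
by rewrite -(mulmxA _ E22) comm mulmxA.
Qed.

End Sl3.

(** * The classification *)

(** The three entries below the diagonal give a linear map from the
    4-dimensional [h] to a 3-dimensional space, which cannot be injective. *)
Lemma exists_upper_trig (K : fieldType) (h : {vspace 'M[K]_3}) :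
    \dim h = 4%N ->
  exists x, [/\ x \in h, x != 0 & forall i j : 'I_3, (j < i)%N -> x i j = 0].
Proof.
move=> dimh.
pose low (z : 'M[K]_3) : 'rV[K]_3 :=
  \row_j (if j == 0 then z 1 0 else if j == 1 then z 2%:R 0 else z 2%:R 1).
have low_linear : linear low.
  move=> c u v; apply/rowP=> j; rewrite !mxE.
  by do 2?[case: ifP => _]; rewrite ?mxE.
pose lowL : {linear 'M[K]_3 -> 'rV[K]_3} :=
  HB.pack low (GRing.isLinear.Build _ _ _ _ low low_linear).
have kerV : (h :&: lker (linfun lowL) != 0)%VS.
  have img_le3 : (\dim (linfun lowL @: h) <= 3)%N.
    by rewrite (leq_trans (dimvS (subvf _))) ?dimvf.
  rewrite -dimv_eq0; apply: contraTN img_le3 => /eqP ker0.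
  by have := limg_ker_dim (linfun lowL) h; rewrite ker0 dimh add0n => ->.
exists (vpick (h :&: lker (linfun lowL))%VS).
have := memv_pick (h :&: lker (linfun lowL))%VS.
rewrite memv_cap memv_ker lfunE /=.
rewrite vpick0; move: (vpick _) => x /andP[hx /eqP/rowP low0]; split=> //.
have := (low0 0, low0 1, low0 2%:R); rewrite !mxE /= => -[[x10 x20] x21].
case=> -[|[|[|//]]] lti [[|[|[|//]]] ltj] // _.
- by rewrite -[RHS]x10; congr (x _ _); apply: val_inj.
- by rewrite -[RHS]x20; congr (x _ _); apply: val_inj.
by rewrite -[RHS]x21; congr (x _ _); apply: val_inj.
Qed.

(** For [x] upper triangular in [h] and not nilpotent, either [ad x] is
    nilpotent on [h] and a spectral projector of [x] will do, or the nonzero Fitting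
    component of [h] contains a nilpotent eigenvector of [ad x]. *)
Lemma exists_commuting_idempotent (K : numFieldType) (h m : {vspace 'M[K]_3}) :
    reductive_pair (sl K 3) h m -> \dim h = 4%N ->
  exists e : 'M[K]_3, [/\ e *m e = e, \tr e = 1 &
    {in h, forall z, e *m z = z *m e}].
Proof.
move=> red dimh; have [x [hx x0 trig_x]] := exists_upper_trig dimh.
have [x3 | x3] := eqVneq (x *m x *m x) 0.
  exact: nilpotent_idempotent red dimh hx x0 x3.
have [[hsl hlie] _ _ _] := red.
have adh : (ad x @: h <= h)%VS.
  by apply/subvP=> _ /memv_imgP[z hz ->]; rewrite adE hlie.
(* The Fitting component of [h] on which [ad x] is bijective. *)
pose W := iter (\dim h) (fun V => ad x @: V)%VS h.
have adW : (ad x @: W)%VS = W := fitting_img_stable adh.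
have Wh : (W <= h)%VS.
  rewrite /W; elim: (\dim h) => //= n IHn.
  exact: subv_trans (limgS _ IHn) adh.
have [W0 | W0] := eqVneq W 0%VS.
  have trx : \tr x = 0 by apply/eqP; rewrite -mem_sl (subvP hsl).
  have [e [ee tre comm]] := upper_trig_idempotent trig_x trx x3.
  exists e; split=> // z hz; apply: (comm (\dim h)).
  have := memv_iter_img (ad x) (\dim h) hz; rewrite -/W W0 memv0 iter_adE.
  by move/eqP.
have lieW : {in W, forall z, lie x z \in W}.
  by move=> z Wz; rewrite -adE -adW memv_img.
have [y Wy [y0 [l xy]]] := ad_trig_eigenvector trig_x lieW W0.
apply: (nilpotent_idempotent red dimh (subvP Wh _ Wy) y0).
apply: (lie_eigen_nilpotent _ xy); apply: contra_neq y0 => l0.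
have kerW : (W :&: lker (ad x) = 0)%VS.
  apply/eqP; rewrite -dimv_eq0 -(eqn_add2r (\dim (ad x @: W)%VS)).
  by rewrite limg_ker_dim adW.
apply/eqP; rewrite -memv0 -kerW memv_cap Wy memv_ker adE xy l0.
by rewrite scale0r eqxx.
Qed.

Theorem proposition5 (R : realType) :
  let g : {vspace 'M[R]_3} := sl R 3 in
  let h0 : {vspace 'M[R]_3} := <<[:: e R 5; e R 6; e R 7; e R 8]>>%VS in
  let m0 : {vspace 'M[R]_3} := <<[:: e R 1; e R 2; e R 3; e R 4]>>%VS in
  [/\ reductive_pair g h0 m0, \dim h0 = 4%N, lie_generates g m0
    & lie_isomorphic h0 (gl R 2)] /\
  (forall h m : {vspace 'M[R]_3},
     reductive_pair g h m -> \dim h = 4%N -> lie_generates g m ->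
     exists a : 'M[R]_3,
       [/\ \det a = 1, (Ad a @: h)%VS = h0 & (Ad a @: m)%VS = m0]).
Proof.
split.
  split; [exact: reductive_pair_gl2 | exact: dim_gl2
    | exact: offdiag_generates | exact: gl2_isomorphic].
move=> h m red dimh _.
have [c [cc trc comm]] := exists_commuting_idempotent red dimh.
exact: reductive_pair_idempotent red dimh cc trc comm.
Qed.
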